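(* Let $a=u+iv$ be a root of $1+x^N=0$ (in the sense that $x+a$ is a factor of $1+x^N$). Then the contribution of $a$ and $\bar a=u-iv$ to the iterated integral of $\ln(1+x^N)$ is given by $$-\frac{1}{n!}\sum_{k=1}^{n}\frac{x^k}{k}\left[(x+a)^{n-k}+(x+\bar a)^{n-k}\right] + \frac{1}{i\,n!}\left[(x+a)^n-(x+\bar a)^n\right]\arctan\left(\frac{vx}{1+ux}\right) + \frac{(x+a)^n+(x+\bar a)^n}{2\,n!}\,\ln\left[(1+ux)^2+v^2x^2\right].$$
   Context: The iterated integrals of a function $f_0(x)$ are defined by $f_n(x)=\int_0^x f_{n-1}(t)\,dt$ for $n\ge1$. A polynomial is factored as $P(x)=\prod_{j=1}^m (x+z_j)$, and the numbers $z_j$ are what is referred to as its roots; here $P(x)=1+x^N$. Since $\ln P(x)=\sum_j \ln(x+z_j)$, the $n$-th iterated integral of $\ln P(x)$ is the sum of the $n$-th iterated integrals of the functions $\ln(x+z_j)$; the contribution of $a$ and $\bar a$ is the sum of the $n$-th iterated integrals of $\ln(x+a)$ and $\ln(x+\bar a)$.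
   Formalization: The formula with the principal arctan is asserted only for 1+ux>0 (it fails or is undefined otherwise); for v≠0 and all real x the arctan is replaced by the argument of (1+ux)+ivx; for v=0 only x>-1 is covered, where ln(x+1) is real. *)

(* Defs.v *)
From Stdlib Require Export Reals Factorial List.
From Coquelicot Require Export Coquelicot.
Open Scope R_scope.

(** Argument of [x + i y] in [(-PI, PI]]; it is [atan (y / x)] when [0 < x].
    The value at [x = y = 0] is conventional. *)
Definition atan2 (y x : R) : R :=
  if Rlt_dec 0 x then atan (y / x)
  else if Rlt_dec x 0 then
    (if Rle_dec 0 y then atan (y / x) + PI else atan (y / x) - PI)
  else if Rlt_dec 0 y then PI / 2
  else if Rlt_dec y 0 then - (PI / 2)
  else 0.

(** Principal branch. *)
Definition Cln (z : C) : C := (ln (Cmod z), atan2 (Im z) (Re z)).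

(** [RInt] is the oriented integral, so [x < 0] is allowed. *)
Fixpoint iter_int (f0 : R -> C) (n : nat) (x : R) : C :=
  match n with
  | O => f0 x
  | S m => RInt (V := C_R_CompleteNormedModule) (iter_int f0 m) 0 x
  end.

(** Coefficients are listed from the constant term upwards. *)
Definition Chorner (q : list C) (z : C) : C :=
  fold_right (fun c acc => (c + z * acc)%C) (RtoC 0) q.

(** [x + a] divides the polynomial function [P] in C[x]. *)
Definition linear_factor (a : C) (P : C -> C) : Prop :=
  exists q : list C, forall z : C, P z = ((z + a) * Chorner q z)%C.

Definition contribution (a : C) (n : nat) (x : R) : C :=
  (iter_int (fun t => Cln (RtoC t + a)) n x
   + iter_int (fun t => Cln (RtoC t + Cconj a)) n x)%C.

(* Main.v *)
Require Import Defs.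
From Stdlib Require Import Lra Lia.

(** Let [S_n(x)] be the sum of [x^k (x + a)^(n-k) / k] over [1 <= k <= n]. The
    recursion [S_(n+1) = (x + a) S_n + x^(n+1) / (n+1)] gives
    [S_(n+1)' = (x + a)^n + (n+1) S_n], and therefore
    [((x + a)^n (ln (x + a) - ln a) - S_n + x^n ln a) / n!] is the [n]-th iterated
    integral of [ln (x + a)] as long as the segment from [a] to [x + a] avoids the
    branch cut. A root has [|a| = 1], so the terms in [ln a] and [ln (Cconj a)]
    cancel, and [1 + x a = a (x + Cconj a)] turns the variation of the argument of
    [x + a] into minus the argument of [1 + x a]. *)

(** * Differentiation of complex functions of a real variable *)

(** [Re] and [Im] are continuous linear maps, which gives one direction; the other rebuilds [f] as
    [Re f * 1 + Im f * Ci]. *)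
Lemma is_derive_C (f : R -> C) (x : R) (l : C) :
  is_derive (V := C_R_NormedModule) f x l <->
  is_derive (fun t => Re (f t)) x (Re l) /\ is_derive (fun t => Im (f t)) x (Im l).
Proof.
split.
- intros H; split.
  + apply (filterdiff_comp' (V := C_R_NormedModule) f Re x _ Re H).
    apply filterdiff_linear.
    apply (is_linear_fst (U := R_NormedModule) (V := R_NormedModule)).
  + apply (filterdiff_comp' (V := C_R_NormedModule) f Im x _ Im H).
    apply filterdiff_linear.
    apply (is_linear_snd (U := R_NormedModule) (V := R_NormedModule)).
- intros [Hr Hi].
  apply is_derive_ext with
    (fun t => plus (scal (Re (f t)) (RtoC 1 : C_R_NormedModule)) (scal (Im (f t)) (Ci : C_R_NormedModule))).
  { intros t; rewrite (surjective_pairing (f t)).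
    apply injective_projections; cbn; unfold mult; cbn; ring. }
  replace l with
    (plus (scal (Re l) (RtoC 1 : C_R_NormedModule)) (scal (Im l) (Ci : C_R_NormedModule))).
  2: { apply injective_projections; cbn; unfold mult; cbn; unfold Re, Im; ring. }
  apply (is_derive_plus (V := C_R_NormedModule));
    now apply (is_derive_scal_l (V := C_R_NormedModule)).
Qed.

Lemma is_derive_Cext (f g : R -> C) (x : R) (l : C) :
  (forall t, f t = g t) ->
  is_derive (V := C_R_NormedModule) f x l -> is_derive (V := C_R_NormedModule) g x l.
Proof. exact (is_derive_ext (V := C_R_NormedModule) f g x l). Qed.

Lemma is_derive_Cplus (f g : R -> C) (x : R) (df dg : C) :
  is_derive (V := C_R_NormedModule) f x df ->
  is_derive (V := C_R_NormedModule) g x dg ->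
  is_derive (V := C_R_NormedModule) (fun t => f t + g t)%C x (df + dg)%C.
Proof. exact (is_derive_plus (V := C_R_NormedModule) f g x df dg). Qed.

Lemma is_derive_Cmult (f g : R -> C) (x : R) (df dg : C) :
  is_derive (V := C_R_NormedModule) f x df ->
  is_derive (V := C_R_NormedModule) g x dg ->
  is_derive (V := C_R_NormedModule) (fun t => f t * g t)%C x (df * g x + f x * dg)%C.
Proof.
intros [Hfr Hfi]%is_derive_C [Hgr Hgi]%is_derive_C.
apply is_derive_C; split.
- replace (Re (df * g x + f x * dg)) with
    (minus (plus (mult (Re df) (Re (g x))) (mult (Re (f x)) (Re dg)))
       (plus (mult (Im df) (Im (g x))) (mult (Im (f x)) (Im dg)))).
  2: { unfold minus, plus, opp, mult; cbn; unfold Re, Im; cbn; ring. }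
  apply (is_derive_minus (V := R_NormedModule));
    apply (is_derive_mult (K := R_AbsRing)); try assumption;
    intros; apply Rmult_comm.
- replace (Im (df * g x + f x * dg)) with
    (plus (plus (mult (Re df) (Im (g x))) (mult (Re (f x)) (Im dg)))
       (plus (mult (Im df) (Re (g x))) (mult (Im (f x)) (Re dg)))).
  2: { unfold minus, plus, opp, mult; cbn; unfold Re, Im; cbn; ring. }
  apply (is_derive_plus (V := R_NormedModule));
    apply (is_derive_mult (K := R_AbsRing)); try assumption;
    intros; apply Rmult_comm.
Qed.

Lemma is_derive_Cconst (c : C) (x : R) :
  is_derive (V := C_R_NormedModule) (fun _ : R => c) x (RtoC 0).
Proof. exact (is_derive_const (V := C_R_NormedModule) c x). Qed.

Lemma is_derive_Cshift (a : C) (x : R) :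
  is_derive (V := C_R_NormedModule) (fun t : R => (t + a)%C) x (RtoC 1).
Proof. apply is_derive_C; split; cbn; auto_derive; auto. Qed.

(** With shift 0 this also differentiates the plain powers of the variable below. *)
Lemma is_derive_Cpow_shift (a : C) (n : nat) (x : R) :
  is_derive (V := C_R_NormedModule) (fun t : R => ((t + a) ^ S n)%C) x
    (INR (S n) * (x + a) ^ n)%C.
Proof.
induction n as [|n IH].
- cbn [INR]; replace (1 * (x + a) ^ 0)%C with (RtoC 1) by (cbn; ring).
  apply is_derive_Cext with (fun t : R => (t + a)%C).
  + intros t; cbn; ring.
  + apply is_derive_Cshift.
- apply is_derive_Cext
    with (fun t : R => ((t + a) * (t + a) ^ S n)%C); [reflexivity|].
  replace (INR (S (S n)) * (x + a) ^ S n)%C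
    with (1 * (x + a) ^ S n + (x + a) * (INR (S n) * (x + a) ^ n))%C.
  + apply is_derive_Cmult; [apply is_derive_Cshift | exact IH].
  + rewrite (S_INR (S n)), RtoC_plus, Cpow_S; ring.
Qed.

(** * The slit plane *)

(** Off the branch cut of [Cln]. *)
Definition slit (z : C) : Prop := Im z <> 0 \/ 0 < Re z.

Lemma slit_conj (z : C) : slit z -> slit (Cconj z).
Proof. unfold slit; cbn; unfold Re, Im; intros [H|H]; [left; lra | now right]. Qed.

(** The imaginary part is constant along the segment; if it is zero, both ends are positive reals,
    and so is everything between them. *)
Lemma slit_segment (a : C) (x t : R) :
  slit a -> slit (x + a)%C -> Rmin 0 x <= t <= Rmax 0 x -> slit (t + a)%C.
Proof.
destruct a as [u v]; unfold slit; cbn; intros H0 Hx Ht.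
destruct (Req_dec v 0) as [->|Hv]; [right | left; lra].
destruct H0 as [H0|H0]; [lra|]; destruct Hx as [Hx|Hx]; [lra|].
revert Ht; unfold Rmin, Rmax; destruct (Rle_dec 0 x); lra.
Qed.

(** * The two-argument arctangent *)

Lemma atan2_pos_re (y x : R) : 0 < x -> atan2 y x = atan (y / x).
Proof. intros Hx; unfold atan2; destruct (Rlt_dec 0 x); [reflexivity | lra]. Qed.

(** Through the cotangent, one formula covers the upper half plane, with no break at [x = 0]. *)
Lemma atan2_pos_im (y x : R) : 0 < y -> atan2 y x = PI / 2 - atan (x / y).
Proof.
intros Hy; unfold atan2.
destruct (Rlt_dec 0 x) as [Hx|Hx].
- rewrite <- atan_inv by now apply Rdiv_lt_0_compat.
  f_equal; field; lra.
- destruct (Rlt_dec x 0) as [Hx'|Hx'].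
  + destruct (Rle_dec 0 y); [|lra].
    replace (y / x) with (- / (- x / y)) by (field; lra).
    rewrite atan_opp, atan_inv by (apply Rdiv_lt_0_compat; lra).
    replace (- x / y) with (- (x / y)) by (field; lra).
    rewrite atan_opp; lra.
  + destruct (Rlt_dec 0 y); [|lra].
    replace x with 0 by lra.
    unfold Rdiv at 3; rewrite Rmult_0_l, atan_0; lra.
Qed.

Lemma atan2_opp (y x : R) : y <> 0 \/ 0 < x -> atan2 (- y) x = - atan2 y x.
Proof.
intros H; unfold atan2.
replace (- y / x) with (- (y / x)) by (unfold Rdiv; ring).
rewrite atan_opp.
repeat (destruct Rlt_dec || destruct Rle_dec); lra.
Qed.

Lemma atan2_neg_im (y x : R) : y < 0 -> atan2 y x = - (PI / 2) - atan (x / y).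
Proof.
intros Hy; rewrite <- (Ropp_involutive y) at 1.
rewrite atan2_opp, atan2_pos_im by lra.
replace (x / - y) with (- (x / y)) by (field; lra).
rewrite atan_opp; lra.
Qed.

(** Only [x] varies, since a real translation fixes the imaginary part. The right, lower and upper
    half planes cover the slit plane, and each has its own smooth formula. *)
Lemma is_derive_atan2 (y x : R) :
  y <> 0 \/ 0 < x -> is_derive (fun t => atan2 y t) x (- y / (x ^ 2 + y ^ 2)).
Proof.
intros H.
destruct (Rlt_dec 0 x) as [Hx|Hx].
- apply (is_derive_ext_loc (fun t => atan (y / t))).
  + exists (mkposreal x Hx); intros t Ht.
    symmetry; apply atan2_pos_re.
    apply Rabs_def2 in Ht; cbn in Ht; unfold minus, plus, opp in Ht; cbn in Ht; lra.
  + auto_derive; [lra|]; field; nra.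
- destruct (Rtotal_order y 0) as [Hy|[Hy|Hy]]; [|lra|].
  + apply (is_derive_ext (fun t => - (PI / 2) - atan (t / y))).
    { intros t; symmetry; now apply atan2_neg_im. }
    auto_derive; [lra|]; field; split; nra.
  + apply (is_derive_ext (fun t => PI / 2 - atan (t / y))).
    { intros t; symmetry; now apply atan2_pos_im. }
    auto_derive; [lra|]; field; split; nra.
Qed.

(** Serves to recognize a difference of arctangents as an argument. *)
Lemma atan2_polar (r p : R) :
  0 < r -> - PI < p < PI -> atan2 (r * sin p) (r * cos p) = p.
Proof.
intros Hr Hp.
assert (Htan : forall q, cos q <> 0 -> r * sin q / (r * cos q) = tan q).
{ intros q Hq; unfold tan; field; lra. }
destruct (Rlt_dec (- (PI / 2)) p) as [H1|H1];
  [destruct (Rlt_dec p (PI / 2)) as [H2|H2]|].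
- assert (Hc := cos_gt_0 p H1 H2).
  rewrite atan2_pos_re, Htan by nra.
  apply atan_tan; lra.
- assert (Hs : 0 < r * sin p) by (apply Rmult_lt_0_compat; [|apply sin_gt_0]; lra).
  rewrite atan2_pos_im by assumption.
  replace (r * cos p / (r * sin p)) with (tan (PI / 2 - p)).
  + rewrite atan_tan; lra.
  + unfold tan; rewrite sin_shift, cos_shift; field; nra.
- assert (Hs : r * sin p < 0).
  { assert (0 < r * sin (- p)) by (apply Rmult_lt_0_compat; [|apply sin_gt_0]; lra).
    rewrite sin_neg in *; lra. }
  rewrite atan2_neg_im by assumption.
  replace (r * cos p / (r * sin p)) with (- tan (PI / 2 - - p)).
  + rewrite atan_opp, atan_tan; lra.
  + unfold tan; rewrite sin_shift, cos_shift, sin_neg, cos_neg; field; nra.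
Qed.

(** The unit vector at angle [atan p] is a positive multiple of [(1, p)]; the value of the factor
    never matters. *)
Lemma cos_sin_atan (p : R) :
  exists r, 0 < r /\ cos (atan p) = r /\ sin (atan p) = r * p.
Proof.
exists (cos (atan p)).
assert (H := atan_bound p).
assert (0 < cos (atan p)) by (apply cos_gt_0; lra).
repeat split; [assumption|].
rewrite <- (tan_atan p) at 3; unfold tan; field; lra.
Qed.

(* [1 + x (u + i v)] is [(u + i v) (x + u - i v)], so its argument is a
   difference of the arguments of [u + i v] and [x + u + i v]. *)
Lemma atan2_sub (u v x : R) :
  u ^ 2 + v ^ 2 = 1 -> v <> 0 ->
  atan2 v (x + u) - atan2 v u = - atan2 (v * x) (1 + u * x).
Proof.
intros Huv Hv.
set (p := (x + u) / v); set (q := u / v).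
(* The imaginary part [v] is common to both arguments, so the constants [PI / 2] or [- (PI / 2)]
   cancel. *)
replace (atan2 v (x + u) - atan2 v u) with (- (atan p - atan q)).
2: { destruct (Rtotal_order v 0) as [H|[H|H]]; [|lra|];
     [rewrite !atan2_neg_im by assumption | rewrite !atan2_pos_im by assumption];
     unfold p, q; ring. }
f_equal.
destruct (cos_sin_atan p) as (r & Hr & Hrc & Hrs).
destruct (cos_sin_atan q) as (s & Hs & Hsc & Hss).
assert (Hv2 : 0 < v ^ 2) by nra.
(* The cosine and sine of the difference are [r * s * (1 + p * q)] and [r * s * (p - q)], that is
   [r * s / v ^ 2] times [1 + u * x] and [v * x]. No multiple of [2 * PI] intervenes, as two
   arctangents differ by less than [PI]. *)
rewrite <- (atan2_polar (v ^ 2 / (r * s)) (atan p - atan q)).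
- rewrite sin_minus, cos_minus, Hrc, Hrs, Hsc, Hss.
  apply f_equal2; [|rewrite <- Huv]; unfold p, q; field; repeat split; lra.
- apply Rdiv_lt_0_compat; nra.
- assert (Hp := atan_bound p); assert (Hq := atan_bound q); lra.
Qed.

(** * The complex logarithm and its derivative *)

Lemma ln_Cmod (z : C) : z <> RtoC 0 -> ln (Cmod z) = / 2 * ln (Re z ^ 2 + Im z ^ 2).
Proof.
intros Hz.
assert (H := proj1 (Cmod_gt_0 z) Hz).
replace (Re z ^ 2 + Im z ^ 2) with (Cmod z * Cmod z).
- rewrite ln_mult by assumption; field.
- unfold Cmod; rewrite sqrt_sqrt; [reflexivity | nra].
Qed.

Lemma slit_neq_0 (z : C) : slit z -> z <> RtoC 0.
Proof. intros H ->; revert H; unfold slit; cbn; lra. Qed.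

Lemma Cln_conj (z : C) : slit z -> Cln (Cconj z) = Cconj (Cln z).
Proof.
intros H; unfold Cln; rewrite Cmod_conj, re_conj, im_conj.
rewrite atan2_opp by exact H; reflexivity.
Qed.

Lemma is_derive_Cln (a : C) (x : R) :
  slit (x + a)%C ->
  is_derive (V := C_R_NormedModule) (fun t : R => Cln (t + a)%C) x (/ (x + a))%C.
Proof.
destruct a as [u v]; intros H.
assert (Hq : 0 < (x + u) ^ 2 + v ^ 2).
{ destruct H as [H|H]; cbn in H; [|nra].
  assert (0 < v * v) by (apply Rsqr_pos_lt; lra).
  assert (0 <= (x + u) ^ 2) by apply pow2_ge_0; lra. }
apply is_derive_C; split.
- apply (is_derive_ext_loc (fun t => / 2 * ln ((t + u) ^ 2 + v ^ 2))).
  (* [ln_Cmod] requires a nonzero argument, so the two functions are compared only near [x], where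
     the squared modulus stays positive. *)
  + assert (Hc : continuous (fun t => (t + u) ^ 2 + v ^ 2) x).
    { apply (ex_derive_continuous (V := R_NormedModule)); auto_derive; exact I. }
    generalize (Hc _ (open_gt 0 _ Hq)); unfold filtermap; apply filter_imp; intros t Ht.
    cbn [Cln Re Im fst]; rewrite ln_Cmod.
    * cbn; now rewrite !Rplus_0_l.
    * intros E; injection E; intros; nra.
  + auto_derive; [lra|]; cbn; field; nra.
- apply (is_derive_ext (fun t => atan2 v (t + u))).
  + intros t; cbn; now rewrite Rplus_0_l.
  + replace (Im (/ (x + (u, v)))) with (scal 1 (- v / ((x + u) ^ 2 + v ^ 2))).
    2: { unfold scal; cbn; unfold mult; cbn; field; nra. }
    apply (is_derive_comp (V := R_NormedModule) (atan2 v) (fun t => t + u)).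
    * apply is_derive_atan2; destruct H as [H|H]; cbn in H; [left; lra | now right].
    * auto_derive; auto.
Qed.

(** * The sums [S_n] *)

Definition log_sum (a : C) (n : nat) (x : R) : C :=
  sum_n_m (G := C_AbelianMonoid)
    (fun k : nat => x ^ k / INR k * (x + a) ^ (n - k))%C 1 n.

Lemma log_sum_0 (a : C) (x : R) : log_sum a 0 x = RtoC 0.
Proof. unfold log_sum; rewrite sum_n_m_zero by lia; reflexivity. Qed.

(** Each old term gains a factor [x + a]; the new term [k = n + 1] carries the power 0 of
    [x + a]. *)
Lemma log_sum_S (a : C) (n : nat) (x : R) :
  log_sum a (S n) x = ((x + a) * log_sum a n x + x ^ S n / INR (S n))%C.
Proof.
unfold log_sum; rewrite sum_n_Sm by lia.
rewrite Nat.sub_diag.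
rewrite (sum_n_m_ext_loc (G := C_AbelianMonoid) _
  (fun k : nat => mult (K := C_Ring) (x + a) (x ^ k / INR k * (x + a) ^ (n - k)))%C).
- rewrite (sum_n_m_mult_l (K := C_Ring)).
  unfold plus, mult; cbn -[INR Cpow].
  change (?z ^ 0)%C with (RtoC 1); ring.
- intros k Hk; rewrite Nat.sub_succ_l by lia.
  unfold mult; cbn -[INR]; ring.
Qed.

Lemma INR_S_neq_0 (n : nat) : RtoC (INR (S n)) <> RtoC 0.
Proof. intros E%RtoC_inj; revert E; apply not_0_INR; lia. Qed.

Lemma log_sum_at_0 (a : C) (n : nat) : log_sum a n 0 = RtoC 0.
Proof.
induction n as [|n IH]; [apply log_sum_0|].
rewrite log_sum_S, IH, Cpow_S; field; apply INR_S_neq_0.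
Qed.

Lemma is_derive_log_sum (a : C) (n : nat) (x : R) :
  is_derive (V := C_R_NormedModule) (log_sum a (S n)) x
    ((x + a) ^ n + INR (S n) * log_sum a n x)%C.
Proof.
assert (Hpow : forall m, is_derive (V := C_R_NormedModule)
    (fun t : R => (t ^ S m / INR (S m))%C) x (x ^ m)%C).
{ intros m.
  replace (x ^ m)%C with (INR (S m) * (x + 0) ^ m * / INR (S m) + (x + 0) ^ S m * 0)%C.
  2: { rewrite Cplus_0_r; field; apply INR_S_neq_0. }
  apply is_derive_Cext
    with (fun t : R => ((t + 0) ^ S m * / INR (S m))%C).
  { intros t; now rewrite Cplus_0_r. }
  apply (is_derive_Cmult (fun t : R => (t + 0) ^ S m)%C (fun _ : R => / INR (S m))%C).
  - apply is_derive_Cpow_shift.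
  - apply is_derive_Cconst. }
induction n as [|n IH].
- apply is_derive_Cext with (fun t : R => (t ^ 1 / INR 1)%C).
  { intros t; rewrite log_sum_S, log_sum_0; ring. }
  rewrite log_sum_0; replace ((x + a) ^ 0 + INR 1 * 0)%C with (x ^ 0)%C by (cbn; ring).
  apply Hpow.
- apply is_derive_Cext
    with (fun t : R => ((t + a) * log_sum a (S n) t + t ^ S (S n) / INR (S (S n)))%C).
  { intros t; now rewrite (log_sum_S a (S n)). }
  (* The recursion folds [(n + 1) * (x + a) * S_n + x ^ (n + 1)] back into [(n + 1) * S_(n+1)]. *)
  replace ((x + a) ^ S n + INR (S (S n)) * log_sum a (S n) x)%C with
    (1 * log_sum a (S n) x + (x + a) * ((x + a) ^ n + INR (S n) * log_sum a n x)
     + x ^ S n)%C.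
  + apply is_derive_Cplus; [|apply Hpow].
    apply is_derive_Cmult; [apply is_derive_Cshift | exact IH].
  + rewrite log_sum_S, (S_INR (S n)), RtoC_plus, (Cpow_S (x + a)).
    field; apply INR_S_neq_0.
Qed.

(** * Iterated integrals of the logarithm *)

Lemma fact_neq_0 (n : nat) : RtoC (INR (fact n)) <> RtoC 0.
Proof. intros E%RtoC_inj; revert E; apply INR_fact_neq_0. Qed.

Definition log_primitive (a : C) (n : nat) (x : R) : C :=
  (/ INR (fact n) * ((x + a) ^ n * (Cln (x + a) - Cln a)
                     - log_sum a n x + x ^ n * Cln a))%C.

Lemma log_primitive_0 (a : C) (x : R) : log_primitive a 0 x = Cln (x + a).
Proof.
unfold log_primitive; rewrite log_sum_0; cbn; field.
Qed.

(** The term [(x + a) ^ n] from differentiating the logarithm cancels the one in the derivative of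
    [S_(n+1)]; what remains has a factor [n + 1], absorbed by the factorial. *)
Lemma is_derive_log_primitive (a : C) (n : nat) (x : R) :
  slit (x + a)%C ->
  is_derive (V := C_R_NormedModule) (log_primitive a (S n)) x (log_primitive a n x).
Proof.
intros H.
assert (Hz := slit_neq_0 _ H).
assert (Hn := INR_S_neq_0 n); assert (Hf := fact_neq_0 n).
replace (log_primitive a n x) with
  (0 * ((x + a) ^ S n * (Cln (x + a) + - Cln a)
        + (-1) * log_sum a (S n) x + (x + 0) ^ S n * Cln a)
   + / INR (fact (S n)) *
     (INR (S n) * (x + a) ^ n * (Cln (x + a) + - Cln a)
      + (x + a) ^ S n * (/ (x + a) + 0)
      + (0 * log_sum a (S n) x + (-1) * ((x + a) ^ n + INR (S n) * log_sum a n x))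
      + (INR (S n) * (x + 0) ^ n * Cln a + (x + 0) ^ S n * 0)))%C.
- apply is_derive_Cext with (fun t : R =>
    (/ INR (fact (S n)) * ((t + a) ^ S n * (Cln (t + a) + - Cln a)
      + (-1) * log_sum a (S n) t + (t + 0) ^ S n * Cln a))%C).
  { intros t; unfold log_primitive; rewrite Cplus_0_r; ring. }
  apply (is_derive_Cmult (fun _ : R => / INR (fact (S n)))%C); [apply is_derive_Cconst|].
  apply is_derive_Cplus; [apply is_derive_Cplus|].
  + apply (is_derive_Cmult (fun t : R => (t + a) ^ S n)%C); [apply is_derive_Cpow_shift|].
    apply is_derive_Cplus; [now apply is_derive_Cln | apply is_derive_Cconst].
  + apply (is_derive_Cmult (fun _ : R => -1)%C); [apply is_derive_Cconst|].
    apply is_derive_log_sum.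
  + apply (is_derive_Cmult (fun t : R => (t + 0) ^ S n)%C); [apply is_derive_Cpow_shift|].
    apply is_derive_Cconst.
- unfold log_primitive; rewrite Cplus_0_r, fact_simpl, mult_INR, RtoC_mult, !Cpow_S.
  field; auto.
Qed.

Lemma iter_int_Cln (a : C) (n : nat) (x : R) :
  slit a -> slit (x + a)%C ->
  iter_int (fun t => Cln (t + a)) n x = log_primitive a n x.
Proof.
intros Ha; revert x; induction n as [|n IH]; intros x Hx.
- symmetry; apply log_primitive_0.
- cbn [iter_int]; apply (is_RInt_unique (V := C_R_CompleteNormedModule)).
  apply is_RInt_ext with (log_primitive a n).
  { intros t Ht; symmetry; apply IH, (slit_segment a x); [assumption..|lra]. }
  replace (log_primitive a (S n) x) with
    (minus (G := C_AbelianGroup) (log_primitive a (S n) x) (log_primitive a (S n) 0)).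
  + apply (is_RInt_derive (V := C_R_CompleteNormedModule)).
    * intros t Ht; apply is_derive_log_primitive, (slit_segment a x); assumption.
    * intros t Ht; assert (Hs := slit_segment a x t Ha Hx Ht).
      apply (ex_derive_continuous (V := C_R_NormedModule)).
      (* Differentiability gives continuity of the integrand: for [n = 0] it is the logarithm
         itself, otherwise a primitive already differentiated. *)
      destruct n as [|n].
      -- exists (/ (t + a))%C.
         apply is_derive_Cext with (fun s : R => Cln (s + a)%C).
         ++ intros s; symmetry; apply log_primitive_0.
         ++ now apply is_derive_Cln.
      -- exists (log_primitive a n t); now apply is_derive_log_primitive.
  (* At 0 the variation of the logarithm, the sum and the positive power of [x] all vanish. *)
  + assert (E : log_primitive a (S n) 0 = RtoC 0).
    { unfold log_primitive; rewrite log_sum_at_0, Cplus_0_l, (Cpow_S 0); ring. }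
    rewrite E; unfold minus, plus, opp; cbn [AbelianGroup.sort]; cbn; ring.
Qed.

(** * Roots of [1 + z ^ N] and conjugate pairs *)

Lemma linear_factor_root (a : C) (P : C -> C) : linear_factor a P -> P (- a)%C = RtoC 0.
Proof. intros [q Hq]; rewrite Hq; ring. Qed.

Lemma Cmod_root_of_minus_1 (N : nat) (z : C) : (1 + z ^ N)%C = RtoC 0 -> Cmod z = 1.
Proof.
intros H.
assert (HN : Cmod z ^ N = 1).
{ rewrite <- Cmod_pow.
  replace (z ^ N)%C with (- RtoC 1)%C; [rewrite Cmod_opp; apply Cmod_1|].
  transitivity (- RtoC 1 + (1 + z ^ N))%C; [rewrite H|]; ring. }
destruct N as [|N].
(* For [N = 0] the polynomial is the constant 2, which has no root. *)
{ injection H; intros; lra. }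
assert (H0 := Cmod_ge_0 z).
destruct (Rtotal_order (Cmod z) 1) as [Hz|[Hz|Hz]]; [|assumption|].
- assert (Cmod z ^ S N < 1) by (apply pow_lt_1_compat; [lra | lia]); lra.
- assert (1 < Cmod z ^ S N) by (apply Rlt_pow_R1; [lra | lia]); lra.
Qed.

Lemma log_sum_add (a b : C) (n : nat) (x : R) :
  sum_n_m (G := C_AbelianMonoid)
    (fun k : nat => x ^ k / INR k * ((x + a) ^ (n - k) + (x + b) ^ (n - k)))%C 1 n
  = (log_sum a n x + log_sum b n x)%C.
Proof.
unfold log_sum; etransitivity; [|apply (sum_n_m_plus (G := C_AbelianMonoid))].
apply (sum_n_m_ext (G := C_AbelianMonoid)); intros k.
apply Cmult_plus_distr_l.
Qed.

(* Since [|a| = 1], the constants of integration [x ^ n / n! * ln a] and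
   [x ^ n / n! * ln (Cconj a)] cancel. *)
Lemma contribution_unit (u v th : R) (n : nat) (x : R) :
  let a : C := (u, v) in
  u ^ 2 + v ^ 2 = 1 -> slit a -> slit (x + a)%C ->
  atan2 v (x + u) - atan2 v u = - th ->
  contribution a n x =
    (- (/ INR (fact n))
       * sum_n_m (G := C_AbelianMonoid)
           (fun k : nat =>
              x ^ k / INR k * ((x + a) ^ (n - k) + (x + Cconj a) ^ (n - k)))
           1 n
     + 1 / (Ci * INR (fact n)) * ((x + a) ^ n - (x + Cconj a) ^ n) * th
     + ((x + a) ^ n + (x + Cconj a) ^ n) / (2 * INR (fact n))
       * ln ((1 + u * x) ^ 2 + v ^ 2 * x ^ 2)%R)%C.
Proof.
intros a Huv Ha Hx Hth; unfold contribution.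
assert (Hconj : Cconj (x + a) = (x + Cconj a)%C).
{ apply injective_projections; cbn; ring. }
rewrite !iter_int_Cln, log_sum_add; try assumption.
2: now apply slit_conj.
2: { rewrite <- Hconj; now apply slit_conj. }
unfold log_primitive.
set (l := ln ((1 + u * x) ^ 2 + v ^ 2 * x ^ 2)).
assert (Hna : ln (Cmod a) = 0).
{ rewrite ln_Cmod by now apply slit_neq_0.
  cbn [a Re Im fst snd]; rewrite Huv, ln_1; ring. }
(* As [u ^ 2 + v ^ 2 = 1], both [(x + u) ^ 2 + v ^ 2] and [(1 + u * x) ^ 2 + v ^ 2 * x ^ 2] equal
   [1 + 2 * u * x + x ^ 2]. *)
assert (Hnx : ln (Cmod (x + a)) = / 2 * l).
{ rewrite ln_Cmod by now apply slit_neq_0.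
  unfold l; do 2 f_equal; cbn; rewrite Rplus_0_l; nra. }
assert (HD : (Cln (x + a) - Cln a = / 2 * l - Ci * th)%C).
{ unfold Cln; rewrite Hna, Hnx; apply injective_projections; cbn.
  - field.
  - rewrite Rplus_0_l; fold (Rminus (atan2 v (x + u)) (atan2 v u)).
    rewrite Hth; field. }
(* Conjugation off the cut only flips the sign of the angle [th]. *)
assert (HD' : (Cln (x + Cconj a) - Cln (Cconj a) = / 2 * l + Ci * th)%C).
{ rewrite <- Hconj, !Cln_conj, <- Cminus_conj, HD by assumption.
  apply injective_projections; cbn; field. }
assert (Hc : Cln (Cconj a) = (- Cln a)%C).
{ rewrite Cln_conj by assumption; unfold Cln; rewrite Hna.
  apply injective_projections; cbn; ring. }
rewrite HD, HD', Hc.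
replace (1 / (Ci * INR (fact n)))%C with (- Ci * / INR (fact n))%C.
- field; apply fact_neq_0.
- assert (HCi : (Ci * Ci)%C = (- RtoC 1)%C).
  { apply injective_projections; cbn; ring. }
  assert (HCi0 : Ci <> RtoC 0) by (intros E; injection E; lra).
  assert (Hf := fact_neq_0 n).
  (* [field] treats [Ci] as an indeterminate, so [Ci * Ci = -1] enters by hand. *)
  transitivity (- (Ci * Ci) / (Ci * INR (fact n)))%C.
  + field; auto.
  + rewrite HCi; field; auto.
Qed.

Theorem theorem3p2 (N : nat) (u v : R) :
  let a : C := (u, v) in
  let abar : C := Cconj a in
  linear_factor a (fun z : C => (1 + z ^ N)%C) ->
  forall (n : nat) (x : R),
  let formula (arctan : R) : C :=
    (- (/ INR (fact n))
       * sum_n_m (G := C_AbelianMonoid)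
           (fun k : nat =>
              x ^ k / INR k * ((x + a) ^ (n - k) + (x + abar) ^ (n - k)))
           1 n
     + 1 / (Ci * INR (fact n)) * ((x + a) ^ n - (x + abar) ^ n) * arctan
     + ((x + a) ^ n + (x + abar) ^ n) / (2 * INR (fact n))
       * ln ((1 + u * x) ^ 2 + v ^ 2 * x ^ 2)%R)%C in
  (0 < 1 + u * x ->
     contribution a n x = formula (atan (v * x / (1 + u * x)))) /\
  (* beyond the pole of v x / (1 + u x), the arctangent is continued along x *)
  (v <> 0 ->
     contribution a n x = formula (atan2 (v * x) (1 + u * x))).
Proof.
intros a abar Hfactor n x formula.
apply linear_factor_root in Hfactor.
assert (Huv : u ^ 2 + v ^ 2 = 1).
{ assert (Hmod := Cmod_root_of_minus_1 N _ Hfactor).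
  rewrite Cmod_opp in Hmod.
  rewrite <- (pow1 2), <- Hmod; unfold Cmod; rewrite pow2_sqrt; [reflexivity|].
  cbn; nra. }
(* A horizontal line off the real axis never meets the cut, so every [x] is allowed. *)
assert (Hv : v <> 0 ->
     contribution a n x = formula (atan2 (v * x) (1 + u * x))).
{ intros Hv; apply contribution_unit; try assumption.
  - now left.
  - left; cbn; lra.
  - now apply atan2_sub. }
split; [intros Hx | exact Hv].
destruct (Req_dec v 0) as [Hv0|Hv0].
2: { rewrite <- atan2_pos_re by assumption; now apply Hv. }
(* A real [a] of modulus 1 is 1 or -1, and -1 would make 1 a root of [1 + z ^ N]. *)
assert (Hu : u = 1).
{ destruct (Req_dec u 1) as [|Hu]; [assumption | exfalso].
  assert (u = -1) by nra.
  replace (- a)%C with (RtoC 1) in Hfactor.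
  - rewrite Cpow_1_l in Hfactor; injection Hfactor; lra.
  - apply injective_projections; cbn; lra. }
(* Now [0 < 1 + u * x] says that [x + a] is a positive real, so all the angles are 0. *)
subst u v; rewrite Rmult_1_l in Hx.
apply contribution_unit; try assumption.
- right; cbn; lra.
- right; cbn; lra.
- rewrite !atan2_pos_re by lra; unfold Rdiv; rewrite !Rmult_0_l, atan_0; ring.
Qed.
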